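(* For every integer $s \geq 5$, there are infinitely many tuples $(n, b, a_1, \ldots, a_{s-1})$ of positive integers satisfying the system \[ \begin{cases} n = a_1 + a_2 + \cdots + a_{s-1},\\ a_1 a_2 \cdots a_{s-1} (a_1 + a_2 + \cdots + a_{s-1}) = b^s. \end{cases} \] *)

(* Defs.v *)
From mathcomp Require Import all_boot.
From mathcomp Require Import classical_sets cardinality.

Set Implicit Arguments.
Unset Strict Implicit.
Unset Printing Implicit Defensive.

(* Main.v *)
Require Import Defs.
From mathcomp Require Import all_boot.
From mathcomp Require Import classical_sets cardinality.
From mathcomp Require Import zify ring.

Set Implicit Arguments.
Unset Strict Implicit.
Unset Printing Implicit Defensive.

Local Open Scope classical_set_scope.
Local Open Scope nat_scope.

(** The equation is homogeneous of degree [s]: multiplying all the [a_i] by [k]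
    multiplies the left-hand side by [k ^ s], so [b] becomes [k * b].  A single
    solution therefore yields infinitely many, and it suffices to produce one
    for each [s >= 5] ([infinite_of_solution], [solution_exists]).

    The number of terms is increased by adjoining to a list its own sum [S].
    Doing this [j] times replaces the sum by [2 ^ j * S] and multiplies the
    product by [S ^ j * 2 ^ 'C(j, 2)], which keeps the prime factors under
    control ([sum_doubling], [prod_doubling]).  Two families result.

    - For odd [s = 2 * i + 7], start from [1, 3, 8, 18, 18], whose product is
      [6 ^ 5] and whose sum is [48 = 6 * 8].  After [j = s - 6] steps the
      product times the sum is [6 ^ s * 2 ^ (3 * (j + 1) + 'C(j + 1, 2))], and
      this exponent of [2] is [(j + 1) / 2 * (j + 6)], a multiple of [s] since
      [j] is odd ([solution_odd]).

    - For even [s = 2 * i + 6], powers of [2] suffice.  Doubling [1] alone gives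
      an exponent of [2] congruent to [s / 2 + 1] modulo [s]; adjoining midway
      two copies of half the current sum, that is two terms for a single
      doubling of the sum, corrects this residue to [0] ([solution_even]).

    The remaining case [s = 5] is the solution [1, 2, 12, 12], since
    [288 * 27 = 6 ^ 5]. *)

(** * Adjoining the sum *)

Definition doubling (j : nat) (l : seq nat) : seq nat :=
  iter j (fun l' => sumn l' :: l') l.

Lemma size_doubling j l : size (doubling j l) = j + size l.
Proof. by elim: j => //= j ->. Qed.

Lemma sum_doubling j l : sumn (doubling j l) = 2 ^ j * sumn l.
Proof.
elim: j => [|j IH] /=; first by rewrite mul1n.
by rewrite -/(doubling j l) IH expnS; ring.
Qed.

Lemma prod_doubling j l :
  \prod_(x <- doubling j l) x
    = 2 ^ 'C(j, 2) * sumn l ^ j * \prod_(x <- l) x.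
Proof.
elim: j => [|j IH] /=; first by rewrite !mul1n.
rewrite big_cons -/(doubling j l) IH sum_doubling binS bin1 expnD expnS.
by ring.
Qed.

Lemma doubling_gt0 j l :
  0 < sumn l -> all (leq 1) l -> all (leq 1) (doubling j l).
Proof.
move=> S_gt0 l_gt0; elim: j => //= j IH.
by rewrite -/(doubling j l) IH sum_doubling muln_gt0 expn_gt0 S_gt0.
Qed.

(** * One solution for each exponent *)

Definition is_solution (s b : nat) (l : seq nat) : Prop :=
  [/\ size l = s.-1, all (leq 1) l, 0 < b
    & (\prod_(x <- l) x) * sumn l = b ^ s].

Lemma solution5 : is_solution 5 6 [:: 1; 2; 12; 12].
Proof. by split=> //; rewrite !big_cons big_nil. Qed.

Lemma bin2_double n : 'C(n, 2).*2 = n * n.-1.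
Proof. by rewrite -mul2n mulnC -[2]/(2`!) bin_ffact ffactnS ffactn1. Qed.

(** The seed has product [6 ^ 5] and sum [6 * 8]: every further factor of the
    sum brings exactly one [6], so the exponent of [6] is [s] whatever the
    number of steps, and only the exponent of [2] has to be checked. *)
Lemma solution_odd i :
  is_solution (i.*2 + 7) (6 * 2 ^ i.+1)
    (doubling i.*2.+1 [:: 1; 3; 8; 18; 18]).
Proof.
split; first by rewrite size_doubling /=; lia.
- exact: doubling_gt0.
- by rewrite muln_gt0 expn_gt0.
rewrite prod_doubling sum_doubling.
have -> : sumn [:: 1; 3; 8; 18; 18] = 6 * 2 ^ 3 by [].
have -> : \prod_(x <- [:: 1; 3; 8; 18; 18]) x = 6 ^ 5.
  by rewrite !big_cons big_nil.
have := bin2_double i.*2.+1; move: 'C(_, 2) => c cE.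
rewrite expnMn -expnM expnMn -expnM.
transitivity (6 ^ (i.*2.+1 + 5 + 1) * 2 ^ (c + 3 * i.*2.+1 + i.*2.+1 + 3)).
  rewrite !expnD expn1.
  by move: (2 ^ c) (6 ^ i.*2.+1) (2 ^ (3 * _)) (6 ^ 5) (2 ^ i.*2.+1) (2 ^ 3)
    => *; ring.
by congr (6 ^ _ * 2 ^ _); nia.
Qed.

Lemma sum_doubling1 j : sumn (doubling j [:: 1]) = 2 ^ j.
Proof. by rewrite sum_doubling muln1. Qed.

Lemma prod_doubling1 j : \prod_(x <- doubling j [:: 1]) x = 2 ^ 'C(j, 2).
Proof. by rewrite prod_doubling big_seq1 exp1n !muln1. Qed.

(** Two copies of half the sum [2 ^ i.+2] double the sum just as the sum itself
    would, but cost one more term and contribute [2 ^ (2 * i + 2)] to the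
    product; placed at this height they make the total exponent of [2] equal
    to [2 * (i + 1) * (i + 3)], which is [s * (i + 1)]. *)
Lemma solution_even i :
  is_solution (i.*2 + 6) (2 ^ i.+1)
    (doubling i [:: 2 ^ i.+1, 2 ^ i.+1 & doubling i.+2 [:: 1]]).
Proof.
have S : sumn [:: 2 ^ i.+1, 2 ^ i.+1 & doubling i.+2 [:: 1]] = 2 ^ i.+3.
  by rewrite [sumn _]/= -/(doubling i.+2 _) sum_doubling1 !expnS; ring.
split; first by rewrite size_doubling [size _]/= size_doubling /=; lia.
- apply: doubling_gt0; first by rewrite S expn_gt0.
  by apply/and3P; split; rewrite ?expn_gt0 //; exact: (@doubling_gt0 i.+2).
- by rewrite expn_gt0.
rewrite prod_doubling sum_doubling S 2!big_cons prod_doubling1.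
have := bin2_double i.+2; have := bin2_double i.
move: 'C(i, 2) 'C(i.+2, 2) => c c2 cE c2E.
rewrite -!expnM -!expnD; congr (2 ^ _).
by case: i {S} cE c2E => [|k] /=; nia.
Qed.

Lemma solution_exists s : 5 <= s -> exists b l, is_solution s b l.
Proof.
move=> hs; have [->|s_neq5] := eqVneq s 5.
  by exists 6, [:: 1; 2; 12; 12]; exact: solution5.
have sE := odd_double_half s; case: (boolP (odd s)) sE => _ sE.
- have -> : s = (s./2 - 3).*2 + 7 by lia.
  by eexists; eexists; exact: solution_odd.
- have -> : s = (s./2 - 3).*2 + 6 by lia.
  by eexists; eexists; exact: solution_even.
Qed.

(** * Scaling *)

Lemma infinite_of_inj (T : Type) (A : set T) (f : nat -> T) :
  injective f -> (forall k, A (f k)) -> infinite_set A.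
Proof.
move=> f_inj fA; apply/infiniteP.
have fT : (f @` [set: nat] #= [set: nat])%card.
  by apply: inj_card_eq => x y _ _ /f_inj.
rewrite -(card_le_eql fT); apply: subset_card_le => _ [k _ <-]; exact: fA.
Qed.

Definition solution_set (s : nat) :=
  [set x : nat * nat * {ffun 'I_s.-1 -> nat} |
    let: (n, b, a) := x in
      [/\ 0 < n, 0 < b, forall i : 'I_s.-1, 0 < a i,
          n = \sum_(i < s.-1) a i
        & (\prod_(i < s.-1) a i) * (\sum_(i < s.-1) a i) = b ^ s]].

Lemma infinite_of_solution s b l :
  1 < s -> is_solution s b l -> infinite_set (@solution_set s).
Proof.
move=> s_gt1 [sz /allP l_gt0 b_gt0 E].
pose a (k : nat) : {ffun 'I_s.-1 -> nat} := [ffun i : 'I_s.-1 => k.+1 * nth 0 l i].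
have sumE k : \sum_(i < s.-1) a k i = k.+1 * sumn l.
  rewrite sumnE (big_nth 0) sz big_mkord big_distrr /=.
  by apply: eq_bigr => i _; rewrite ffunE.
have prodE k : \prod_(i < s.-1) a k i = k.+1 ^ s.-1 * \prod_(x <- l) x.
  rewrite (big_nth 0 predT id) sz big_mkord.
  under eq_bigr do rewrite ffunE.
  by rewrite big_split /= prod_nat_const card_ord.
have S_gt0 : 0 < sumn l.
  have : 0 < b ^ s by rewrite expn_gt0 b_gt0.
  by rewrite -E muln_gt0 => /andP[].
apply: (infinite_of_inj (f := fun k => (k.+1 * sumn l, k.+1 * b, a k))).
  by move=> j k [_ /eqP + _]; rewrite eqn_pmul2r // => /eqP[].
move=> k; split; rewrite ?muln_gt0 ?sumE ?prodE //.
  by move=> i; rewrite ffunE muln_gt0 /= l_gt0 // mem_nth // sz.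
rewrite expnMn -E -[s in RHS](ltn_predK s_gt1) expnS.
by ring.
Qed.

Theorem corollary1p4 (s : nat) (hs : 5 <= s) :
  infinite_set
    [set x : nat * nat * {ffun 'I_s.-1 -> nat} |
      let: (n, b, a) := x in
      [/\ 0 < n, 0 < b, forall i : 'I_s.-1, 0 < a i,
          n = \sum_(i < s.-1) a i
        & (\prod_(i < s.-1) a i) * (\sum_(i < s.-1) a i) = b ^ s]].
Proof.
have [b [l sol]] := solution_exists hs.
by apply: infinite_of_solution sol; lia.
Qed.
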